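(* For integers $n\ge 3$ and $m\ge 0$, let $K_{n,-m}$ be as defined below and $T(K_{n,-m})$ its number of triangulations. Then for all $n,m$ with $1\le m\le n-1$ such that $K_{n,-m}$, $K_{n-1,-(m-1)}$ and $K_{n,-(m+1)}$ are all defined, $$T(K_{n,-m})=T(K_{n-1,-(m-1)})+T(K_{n,-(m+1)}).$$ Moreover, for all $n\ge 3$ and $0\le m\le n-2$, $T(K_{n,-m})=a_{n-2,m}$, where the numbers $a_{k,j}$ ($0\le j\le k$) are determined by $a_{0,0}=1$, $a_{k,k}=0$ for $k\ge1$, $a_{k,0}=a_{k-1,0}+a_{k,1}$ for $k\ge1$, and $a_{k,j}=a_{k-1,j-1}+a_{k,j+1}$ for $1\le j\le k-1$.
   Context: Let $v_0,\dots,v_{n-1}$ be points in convex position labeled in cyclic order (indices mod $n$), and for each $j$ let $e_j=v_{j-1}v_{j+1}$ (a span-2 edge). $K_{n,-m}$ is the complete geometric graph on these points with $m$ consecutive span-2 edges $e_i,e_{i+1},\dots,e_{i+m-1}$ removed; it is defined for $n=3$, $m=0$ (the triangle), for $n=4$, $0\le m\le 2$, and for $n\ge5$, $0\le m\le n$, and it is well defined up to rotation. A triangulation of a geometric graph $G$ on convex points is a triangulation of the convex polygon on these points (a maximal set of pairwise non-crossing diagonals) all of whose diagonals are edges of $G$; $T(G)$ is the number of such triangulations (so $T(K_{3,0})=1$).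
   Formalization: In the ''moreover'' part the pair (n,m)=(3,1) is excluded, since K_{3,-1} is not defined; all other pairs with n≥3 and 0≤m≤n-2 are covered. *)

(* Defs.v *)
From HB Require Import structures.
From mathcomp Require Import all_boot all_order all_algebra.
From mathcomp Require Import boolp.

Set Implicit Arguments.
Unset Strict Implicit.
Unset Printing Implicit Defensive.

Import Order.TTheory GRing.Theory Num.Theory.

Definition K_defined (n m : nat) : bool :=
  [|| (n == 3) && (m == 0), (n == 4) && (m <= 2) | (5 <= n) && (m <= n)].

Definition catalan_array (a : nat -> nat -> nat) : Prop :=
  [/\ a 0 0 = 1,
      forall k, 1 <= k -> a k k = 0,
      forall k, 1 <= k -> a k 0 = a k.-1 0 + a k 1 &
      forall k j, 1 <= j <= k.-1 -> a k j = a k.-1 j.-1 + a k j.+1].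

Lemma catalan_array_exists : exists a, catalan_array a.
Proof.
pose a := fix a k j := if k is k'.+1 then \sum_(j <= i < k'.+1) a k' i.-1
                       else nat_of_bool (j == 0).
have aS k j : a k.+1 j = \sum_(j <= i < k.+1) a k i.-1 by [].
exists a; split=> [//|[|k] // _|[|k] // _|[|k] j].
- by rewrite aS big_geq.
- by rewrite !aS big_ltn.
- by move=> /andP[] /leq_trans h /h.
- by move=> /andP[_ jk]; rewrite !aS big_ltn.
Qed.

Lemma catalan_array_unique a b : catalan_array a -> catalan_array b ->
  forall k j, j <= k -> a k j = b k j.
Proof.
move=> [a0 akk ak0 akj] [b0 bkk bk0 bkj]; elim=> [|k IHk] j.
  by rewrite leqn0 => /eqP ->; rewrite a0 b0.
move=> /subnKC; move: (k.+1 - j) => t; elim: t j => [|t IHt] j.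
  by rewrite addn0 => ->; rewrite (akk k.+1 isT) (bkk k.+1 isT).
rewrite addnS -addSn => jt; have := IHt _ jt; case: j jt => [|j] jt e.
  by rewrite (ak0 k.+1 isT) (bk0 k.+1 isT) e (IHk 0).
have jk : j < k by move: jt; rewrite !addSn => -[<-]; rewrite ltnS leq_addr.
by rewrite (akj k.+1 j.+1 jk) (bkj k.+1 j.+1 jk) e (IHk j (ltnW jk)).
Qed.

Local Open Scope ring_scope.

Section Geometry.
Variables (R : realFieldType) (n : nat).
Implicit Types (v : 'I_n -> 'rV[R]_2) (d e : {set 'I_n}).

Definition convex_position v : Prop :=
  forall i, ~ exists c : 'I_n -> R,
    [/\ forall j, 0 <= c j, c i = 0, \sum_j c j = 1 &
        v i = \sum_j c j *: v j].

(* Twice the signed area of the triangle p q r. *)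
Definition orient (p q r : 'rV[R]_2) : R :=
  let x (a : 'rV[R]_2) := a ord0 ord0 in
  let y (a : 'rV[R]_2) := a ord0 ord_max in
  (x q - x p) * (y r - y p) - (y q - y p) * (x r - x p).

(* The labels follow the boundary of the convex hull (in either direction):
   every line v_i v_(i+1) supports the point set; indices are mod n. *)
Definition cyclic_labels v : Prop :=
  forall i, (forall k, 0 <= orient (v i) (v (ordS i)) (v k))
         \/ (forall k, orient (v i) (v (ordS i)) (v k) <= 0).

Definition convex_points v : Prop := convex_position v /\ cyclic_labels v.

(* An edge is the unordered pair of its endpoints' labels. *)
Definition in_open_segment v e (p : 'rV[R]_2) : Prop :=
  exists i j (t : R),
    [/\ e = [set i; j], 0 < t < 1 & p = (1 - t) *: v i + t *: v j].

Definition crossing v d e : Prop :=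
  d <> e /\ exists p, in_open_segment v d p /\ in_open_segment v e p.

Definition diagonals : {set {set 'I_n}} :=
  [set d : {set 'I_n} | [exists i, exists j,
    [&& d == [set i; j], j != i, j != ordS i & i != ordS j]]].

Definition noncrossing_diagonals v (S : {set {set 'I_n}}) : bool :=
  (S \subset diagonals) &&
  [forall d in S, forall e in S, ~~ `[< crossing v d e >]].

Definition triangulation v (S : {set {set 'I_n}}) : bool :=
  maxset (noncrossing_diagonals v) S.

(* T(G) for the geometric graph G with vertices v and edge set E. *)
Definition num_triangulations v (E : {set {set 'I_n}}) : nat :=
  #|[set S : {set {set 'I_n}} | triangulation v S && (S \subset E)]|.

Definition span2 (j : 'I_n) : {set 'I_n} := [set ord_pred j; ordS j].

(* Edge set of K_{n,-m}; the removed edges are e_i, ..., e_(i+m-1). *)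
Definition K_edges (m : nat) (i : 'I_n) : {set {set 'I_n}} :=
  [set e : {set 'I_n} | #|e| == 2%N] :\:
  [set span2 (iter t (@ordS n) i) | t : 'I_m].

End Geometry.

(* Main.v *)
Require Import Defs.
From mathcomp Require Import all_boot all_order all_algebra.
From mathcomp Require Import boolp zify ring lra.

Set Implicit Arguments.
Unset Strict Implicit.
Unset Printing Implicit Defensive.

Import Order.TTheory GRing.Theory Num.Theory.

(**
Convexity makes the orientation of [v i], [v j], [v k] (with [i < j < k])
constant, so two diagonals cross iff their endpoints alternate around the
polygon and the problem becomes one about sets of chords, invariant under
rotation of the labels. Write [T(n, m)] for the number of triangulations without
the ears at [m] consecutive vertices. Those that moreover avoid the ear at the
next vertex [c] are counted by [T(n, m + 1)]; those that have it are, after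
cutting off [c], the triangulations of the [(n - 1)]-gon without the remaining
[m - 1] ears (none if [m = 0]), because the ear at the vertex before [c] would
cross the one at [c]. This needs [m <= n - 3]. For [m >= n - 2] and [n >= 4] all
the numbers vanish: every triangulation has an ear away from any two adjacent
vertices.
*)

(** * Cyclic successor and predecessor of indices *)

Lemma ord_eqE n (i j : 'I_n) : (i == j) = (i == j :> nat).
Proof. by []. Qed.

Lemma val_ordS n (i : 'I_n) : ordS i = (if i.+1 == n then 0 else i.+1) :> nat.
Proof.
rewrite /=; case: eqP => [->|ne]; first by rewrite modnn.
by rewrite modn_small //; have := ltn_ord i; lia.
Qed.

Lemma val_ord_pred n (i : 'I_n) :
  ord_pred i = (if i == 0 :> nat then n.-1 else i.-1) :> nat.
Proof.
have := ltn_ord i; rewrite /=; case: eqP => [->|ne] lt_in.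
  by rewrite add0n modn_small //; lia.
have -> : (i + n).-1 = i.-1 + n by lia.
by rewrite modnDr modn_small //; lia.
Qed.

Lemma val_iter_ordS n (i : 'I_n) t : i + t < n -> iter t (@ordS n) i = i + t :> nat.
Proof.
elim: t => [|t IHt] lt_n; first by rewrite addn0.
rewrite iterS val_ordS IHt; last by lia.
by case: eqP; lia.
Qed.

Lemma iter_ordS0 n (i : 'I_n.+1) : i = iter i (@ordS n.+1) ord0.
Proof. by apply: ord_inj; rewrite val_iter_ordS ?add0n. Qed.

(** * Orientation of points in convex position *)

Section Geometry.
Local Open Scope ring_scope.

Lemma orient_rot (R : realFieldType) (p q r : 'rV[R]_2) :
  orient q r p = orient p q r.
Proof. by rewrite /orient /=; ring. Qed.

Lemma orient_swap (R : realFieldType) (p q r : 'rV[R]_2) :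
  orient p r q = - orient p q r.
Proof. by rewrite /orient /=; ring. Qed.

Lemma orientxx (R : realFieldType) (p q : 'rV[R]_2) : orient p q q = 0.
Proof. by rewrite /orient /=; ring. Qed.

Lemma orient_conv (R : realFieldType) (p q r s : 'rV[R]_2) (t : R) :
  orient p q ((1 - t) *: r + t *: s) = (1 - t) * orient p q r + t * orient p q s.
Proof. by rewrite /orient /= !mxE; ring. Qed.

Lemma rV2P (R : realFieldType) (p q : 'rV[R]_2) :
  p ord0 ord0 = q ord0 ord0 -> p ord0 ord_max = q ord0 ord_max -> p = q.
Proof.
move=> e0 e1; apply/rowP => -[[|[|//]] lt2].
  by rewrite (_ : Ordinal lt2 = ord0) //; apply: val_inj.
by rewrite (_ : Ordinal lt2 = ord_max) //; apply: val_inj.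
Qed.

(** The parameter [t] is read off from a coordinate in which [p] and [q] differ. *)
Lemma orient_eq0 (R : realFieldType) (p q r : 'rV[R]_2) :
  orient p q r = 0 -> p = q \/ exists t, r = (1 - t) *: p + t *: q.
Proof.
rewrite /orient /= => o0.
have [ex|nx] := eqVneq (q ord0 ord0) (p ord0 ord0).
  have [ey|ny] := eqVneq (q ord0 ord_max) (p ord0 ord_max).
    by left; apply: rV2P.
  have ny' : q ord0 ord_max - p ord0 ord_max != 0 by rewrite subr_eq0.
  right; exists ((r ord0 ord_max - p ord0 ord_max) / (q ord0 ord_max - p ord0 ord_max)).
  apply: rV2P; rewrite !mxE; last by field.
  move/eqP: o0; rewrite ex subrr mul0r sub0r oppr_eq0 mulf_eq0 (negbTE ny') /= subr_eq0.
  by move=> /eqP ->; ring.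
have nx' : q ord0 ord0 - p ord0 ord0 != 0 by rewrite subr_eq0.
right; exists ((r ord0 ord0 - p ord0 ord0) / (q ord0 ord0 - p ord0 ord0)).
apply: rV2P; rewrite !mxE; first by field.
apply: (mulfI nx'); apply/eqP; rewrite -subr_eq0 -o0; apply/eqP; field.
exact: nx'.
Qed.

(** Otherwise the weights [1 - t] on [j] and [t] on [k] would make [v i] a convex combination of
    other points. The case [j = k] says that [v] is injective. *)
Lemma convex_position_notin_segment (R : realFieldType) n (v : 'I_n -> 'rV[R]_2)
    (i j k : 'I_n) (t : R) :
  convex_position v -> i != j -> i != k -> 0 <= t <= 1 ->
  v i <> (1 - t) *: v j + t *: v k.
Proof.
move=> cv ij ik /andP[t0 t1] vi; apply: (cv i).
have sum_delta (l : 'I_n) : \sum_x (x == l)%:R = 1 :> R.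
  by rewrite (bigD1 l) //= eqxx big1 ?addr0 // => x /negbTE ->.
have sum_pick (l : 'I_n) : \sum_x (x == l)%:R *: v x = v l.
  rewrite (bigD1 l) //= eqxx scale1r big1 ?addr0 // => x /negbTE ->.
  exact: scale0r.
exists (fun l => (1 - t) * (l == j)%:R + t * (l == k)%:R); split.
- by move=> l; rewrite addr_ge0 // mulr_ge0 ?ler0n // subr_ge0.
- by rewrite (negbTE ij) (negbTE ik) !mulr0 addr0.
- by rewrite big_split /= -!mulr_sumr !sum_delta !mulr1 subrK.
- under eq_bigr do rewrite scalerDl -!scalerA.
  by rewrite big_split /= -!scaler_sumr !sum_pick.
Qed.

(** Of three collinear points one lies on the segment between the other two: [v i], [v k] or [v j]
    according as [t < 0], [0 <= t <= 1] or [1 < t]. *)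
Lemma convex_position_noncollinear (R : realFieldType) n (v : 'I_n -> 'rV[R]_2)
    (i j k : 'I_n) :
  convex_position v -> i != j -> j != k -> i != k ->
  orient (v i) (v j) (v k) != 0.
Proof.
move=> cv ij jk ik; apply/eqP => /orient_eq0[eq_v|[t vk]].
  apply: (@convex_position_notin_segment _ _ _ i j j 0 cv ij ij).
    by rewrite lexx ler01.
  by rewrite subr0 scale1r scale0r addr0.
have [ji ki kj] : [/\ j != i, k != i & k != j] by rewrite !(eq_sym j) !(eq_sym k).
have [t0|t0] := leP 0 t; last first.
  have nt : 1 - t != 0 by rewrite gt_eqF // subr_gt0 (lt_trans t0 ltr01).
  apply: (@convex_position_notin_segment _ _ _ i j k (1 - t)^-1 cv ij ik).
    have t1 : 1 <= 1 - t by lra.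
    by rewrite invr_ge0 (le_trans ler01 t1) invf_le1 // (lt_le_trans ltr01 t1).
  by rewrite vk; apply: rV2P; rewrite !mxE; field.
have [t1|t1] := leP t 1.
  by apply: (@convex_position_notin_segment _ _ _ k i j t cv ki kj); rewrite ?t0.
have nt : t != 0 by rewrite gt_eqF // (lt_trans ltr01 t1).
apply: (@convex_position_notin_segment _ _ _ j i k t^-1 cv ji jk).
  by rewrite invr_ge0 t0 invf_le1 ?(ltW t1) // (lt_trans ltr01 t1).
by rewrite vk; apply: rV2P; rewrite !mxE; field.
Qed.

(** Noncollinearity makes each supporting line strict. Consecutive sides share a triangle, so the
    sign found at one side is passed on around the polygon. *)
Lemma convex_points_sides (R : realFieldType) n (v : 'I_n -> 'rV[R]_2) :
  (3 <= n)%N -> convex_points v ->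
  exists s : R, forall i k : 'I_n, k != i -> k != ordS i ->
    0 < s * orient (v i) (v (ordS i)) (v k).
Proof.
case: n v => // n v n2 [cv lv].
have ordS_neq (i : 'I_n.+1) : ordS i != i.
  by rewrite ord_eqE val_ordS; case: ifP; lia.
have ordSS_neq (i : 'I_n.+1) : ordS (ordS i) != i.
  by rewrite ord_eqE !val_ordS; have := ltn_ord i; do !case: ifP; lia.
have same_side (s : R) (i l : 'I_n.+1) :
    l != i -> l != ordS i -> 0 < s * orient (v i) (v (ordS i)) (v l) ->
    forall k, k != i -> k != ordS i -> 0 < s * orient (v i) (v (ordS i)) (v k).
  move=> li lSi sl k ki kSi.
  have := convex_position_noncollinear cv
    (_ : i != ordS i) (_ : ordS i != k) (_ : i != k).
  rewrite eq_sym ordS_neq eq_sym kSi eq_sym ki => /(_ isT isT isT) nk.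
  move: sl; case: (lv i) => lvi; have := lvi k; have := lvi l; rewrite le_eqVlt.
    move=> /orP[/eqP <-|l0]; first by rewrite mulr0 ltxx.
    by rewrite le_eqVlt eq_sym (negbTE nk) /= => k0; rewrite !pmulr_lgt0.
  move=> /orP[/eqP ->|l0]; first by rewrite mulr0 ltxx.
  by rewrite le_eqVlt (negbTE nk) /= => k0; rewrite !nmulr_lgt0.
(* Only the sign of [o] matters; at the first side the claim becomes the positivity of a square. *)
set o := orient (v ord0) (v (ordS ord0)) (v (ordS (ordS ord0))).
exists o => i; rewrite [i]iter_ordS0; elim: (nat_of_ord i) => [|t IHt] k /=.
  apply: (same_side o _ (ordS (ordS ord0))) => //.
  rewrite -expr2 exprn_even_gt0 //=.
  by apply: convex_position_noncollinear; rewrite // eq_sym.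
set x := iter t _ _ in IHt *.
apply: (same_side o _ x); rewrite 1?eq_sym //.
by rewrite orient_rot; apply: IHt.
Qed.

(* Seen from [v i], the other points lie on one side of the line through [v i]
   and [v (ordS i)], so the Pluecker relation makes [orient (v i)] transitive. *)
Lemma convex_points_orient (R : realFieldType) n (v : 'I_n -> 'rV[R]_2) :
  (3 <= n)%N -> convex_points v ->
  exists s : R, forall i j k : 'I_n, (i < j)%N -> (j < k)%N ->
    0 < s * orient (v i) (v j) (v k).
Proof.
move=> n3 /(convex_points_sides n3)[s side]; exists s => i j k ij jk.
have step (x y : 'I_n) : (x < y)%N -> ordS x = x.+1 :> nat.
  by move=> xy; rewrite val_ordS; have := ltn_ord y; case: ifP; lia.
have lt_neq (x y : 'I_n) : (x < y)%N -> y != x.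
  by rewrite ord_eqE; lia.
have base (x : 'I_n) : ((ordS i) < x)%N -> 0 < s * orient (v i) (v (ordS i)) (v x).
  move=> ix; apply: side; apply: lt_neq => //.
  by apply: ltn_trans ix; rewrite (step _ _ ij).
have succ (x y : 'I_n) : (i < x)%N -> y = x.+1 :> nat ->
    0 < s * orient (v i) (v x) (v y).
  move=> ix yx; have yE : y = ordS x by apply: ord_inj; rewrite (step x y) ?yx.
  rewrite -orient_rot yE; apply: side; first by rewrite eq_sym lt_neq.
  by rewrite eq_sym lt_neq // -yE yx; lia.
have [t kt] : exists t, (k = j + t.+1 :> nat)%N by exists (k - j.+1)%N; lia.
elim: t k {jk} kt => [|t IHt] k kt; first by apply: succ; rewrite // kt addn1.
have lt_l : (k.-1 < n)%N by have := ltn_ord k; lia.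
pose l := Ordinal lt_l.
have sjl : 0 < s * orient (v i) (v j) (v l) by apply: IHt; rewrite /= kt; lia.
have slk : 0 < s * orient (v i) (v l) (v k) by apply: succ; rewrite /= kt; lia.
have [jE|jE] := eqVneq j (ordS i).
  by rewrite jE; apply: base; rewrite -jE kt; lia.
have ltj : (ordS i < j)%N by move: jE; rewrite ord_eqE (step _ _ ij); lia.
have sj := base j ltj.
have sk : 0 < s * orient (v i) (v (ordS i)) (v k) by apply: base; lia.
have sl : 0 < s * orient (v i) (v (ordS i)) (v l).
  by apply: base; rewrite (_ : nat_of_ord l = k.-1) // kt; lia.
(* Writing [[x y]] for the orientation seen from [i], and with [l = k - 1], the relation is [[i+1 l]
   [j k] = [i+1 j] [l k] + [i+1 k] [j l]]. *)
rewrite -(pmulr_rgt0 _ sl).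
rewrite [X in 0 < X](_ : _ =
    (s * orient (v i) (v (ordS i)) (v j)) * (s * orient (v i) (v l) (v k))
  + (s * orient (v i) (v (ordS i)) (v k)) * (s * orient (v i) (v j) (v l))).
  by rewrite addr_gt0 // mulr_gt0.
by rewrite /orient /=; ring.
Qed.

(** Cramer's rule gives the parameters as ratios of signed areas; they lie strictly between 0 and 1
    because the two areas involved have opposite signs. *)
Lemma segments_meet (R : realFieldType) (p q r s : 'rV[R]_2) :
  orient p q r * orient p q s < 0 -> orient r s p * orient r s q < 0 ->
  exists t t' : R, [/\ 0 < t < 1, 0 < t' < 1 &
    (1 - t) *: p + t *: q = (1 - t') *: r + t' *: s].
Proof.
have ratio (a b : R) : a * b < 0 -> a - b != 0 /\ 0 < a / (a - b) < 1.
  have [a0|a0|->] := ltgtP a 0; last by rewrite mul0r ltxx.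
    rewrite nmulr_rlt0 // => b0; have ab : a - b < 0 by lra.
    by rewrite lt_eqF // nmulr_rgt0 // invr_lt0 ab ltr_ndivrMr // mul1r; split=> //=; lra.
  rewrite pmulr_rlt0 // => b0; have ab : 0 < a - b by lra.
  by rewrite gt_eqF // divr_gt0 //= ltr_pdivrMr // mul1r; split=> //; lra.
move=> /ratio[n1 b1] /ratio[n2 b2].
exists (orient r s p / (orient r s p - orient r s q)).
exists (orient p q r / (orient p q r - orient p q s)).
split=> //; move: n1 n2; rewrite /orient /= => n1 n2.
by apply: rV2P; rewrite !mxE; field; rewrite n1 n2.
Qed.

(** [orient p q] is affine and vanishes on the line through [p] and [q]. At an interior point of the
    other segment it is a positive combination of two numbers of the same weak sign, not both
    zero. *)
Lemma segments_disjoint (R : realFieldType) (p q r s : 'rV[R]_2) (t t' : R) :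
  0 < t' < 1 -> 0 <= orient p q r * orient p q s ->
  (orient p q r != 0) || (orient p q s != 0) ->
  (1 - t) *: p + t *: q <> (1 - t') *: r + t' *: s.
Proof.
move=> /andP[t0 t1] ge0 ne0 /(congr1 (orient p q)).
rewrite !orient_conv orientxx -[orient p q p]orient_rot orientxx !mulr0 addr0.
have t1' : 0 < 1 - t' by rewrite subr_gt0.
move: ge0 ne0; move: (orient p q r) (orient p q s) => x y ge0 ne0 /eqP.
have [x0|x0|x0] := ltgtP x 0.
- have y0 : y <= 0 by rewrite -(nmulr_rge0 _ x0).
  rewrite gt_eqF // -oppr_gt0 opprD -!mulrN.
  by rewrite ltr_wpDr ?mulr_gt0 ?oppr_gt0 // mulr_ge0 ?oppr_ge0 // ltW.
- have y0 : 0 <= y by rewrite -(pmulr_rge0 _ x0).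
  by rewrite lt_eqF // ltr_wpDr ?mulr_gt0 // mulr_ge0 // ltW.
rewrite x0 mulr0 add0r eq_sym mulf_eq0 gt_eqF //= => /eqP y0.
by move: ne0; rewrite x0 y0 eqxx.
Qed.
End Geometry.

(** * Interleaving of chords *)

(** Stated for arbitrary sets rather than pairs, so that it can be transported along monotone maps
    and rotations. *)
Definition alternating n (d e : {set 'I_n}) : bool :=
  [exists a in d, exists b in e, exists c in d, exists f in e,
    [&& a < b, b < c & c < f]].

Definition interleaved n (d e : {set 'I_n}) : bool :=
  alternating d e || alternating e d.

Lemma alternatingP n (d e : {set 'I_n}) :
  reflect (exists a b c f, [/\ a \in d, b \in e, c \in d, f \in e &
             [/\ a < b, b < c & c < f]])
          (alternating d e).
Proof.
apply: (iffP idP).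
  move=> /exists_inP[a ad /exists_inP[b be /exists_inP[c cd /exists_inP[f fe]]]].
  by move=> /and3P H; exists a, b, c, f.
move=> [a [b [c [f [ad be cd fe H]]]]].
apply/exists_inP; exists a => //; apply/exists_inP; exists b => //.
apply/exists_inP; exists c => //; apply/exists_inP; exists f => //.
exact/and3P.
Qed.

Lemma interleaved_sym n (d e : {set 'I_n}) : interleaved d e = interleaved e d.
Proof. exact: orbC. Qed.

Lemma alternating_pair n (i j k l : 'I_n) : i < j -> k < l ->
  alternating [set i; j] [set k; l] = [&& i < k, k < j & j < l].
Proof.
move=> ij kl; apply/alternatingP/and3P => [|H]; last first.
  by exists i, k, j, l; split; rewrite // !inE eqxx ?orbT.
move=> [a [b [c [f [/set2P aE /set2P bE /set2P cE /set2P fE [ab bc cf]]]]]].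
have [aE' cE'] : a = i /\ c = j.
  by move: (ltn_trans ab bc); case: aE cE => -> [] ->; split=> //; lia.
have [bE' fE'] : b = k /\ f = l.
  by move: (ltn_trans bc cf); case: bE fE => -> [] ->; split=> //; lia.
by rewrite -aE' -bE' -cE' -fE'.
Qed.

Lemma interleaved_pair n (i j k l : 'I_n) : i < j -> k < l ->
  interleaved [set i; j] [set k; l] =
  [&& i < k, k < j & j < l] || [&& k < i, i < l & l < j].
Proof. by move=> ij kl; rewrite /interleaved !alternating_pair. Qed.

Lemma interleaved_imset_mono m n (f : 'I_m -> 'I_n) (d e : {set 'I_m}) :
  {mono f : i j / i < j} -> interleaved (f @: d) (f @: e) = interleaved d e.
Proof.
move=> fM; have altf (x y : {set 'I_m}) : alternating (f @: x) (f @: y) = alternating x y.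
  apply/alternatingP/alternatingP => -[a [b [c [g [ad be cd ge H]]]]]; last first.
    by exists (f a), (f b), (f c), (f g); rewrite !imset_f ?fM.
  case/imsetP: ad H => a' ad ->; case/imsetP: be => b' be ->.
  case/imsetP: cd => c' cd ->; case/imsetP: ge => g' ge ->; rewrite !fM => H.
  by exists a', b', c', g'.
by rewrite /interleaved !altf.
Qed.

(** The shift keeps the order, except that the last index becomes 0. An alternation whose last point
    wraps around then starts with the other chord, which is why [interleaved] allows both orders. *)
Lemma interleaved_ordS n (d e : {set 'I_n}) :
  interleaved ((@ordS n) @: d) ((@ordS n) @: e) = interleaved d e.
Proof.
have ordS_lt (x y : 'I_n) : x < y -> ordS x = x.+1 :> nat.
  by move=> xy; rewrite val_ordS; have := ltn_ord y; case: ifP; lia.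
have ordS_last (x : 'I_n) : (x.+1 < n) = false -> ordS x = 0 :> nat.
  by rewrite val_ordS; have := ltn_ord x; case: ifP; lia.
have ordS_nlast (x : 'I_n) : x.+1 < n -> ordS x = x.+1 :> nat.
  by rewrite val_ordS; case: ifP; lia.
have fwd (x y : {set 'I_n}) : alternating x y ->
    interleaved ((@ordS n) @: x) ((@ordS n) @: y).
  move=> /alternatingP[a [b [c [f [ax bv cx fy [ab bc cf]]]]]].
  have [eq_a eq_b eq_c] := And3 (ordS_lt _ _ ab) (ordS_lt _ _ bc) (ordS_lt _ _ cf).
  apply/orP; case lf: (f.+1 < n).
    left; apply/alternatingP; exists (ordS a), (ordS b), (ordS c), (ordS f).
    by rewrite !imset_f // eq_a eq_b eq_c (ordS_nlast _ lf).
  right; apply/alternatingP; exists (ordS f), (ordS a), (ordS b), (ordS c).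
  by rewrite !imset_f // eq_a eq_b eq_c (ordS_last _ lf).
have bwd (x y : {set 'I_n}) : alternating ((@ordS n) @: x) ((@ordS n) @: y) ->
    interleaved x y.
  move=> /alternatingP[? [? [? [? [/imsetP[a ax ->] /imsetP[b bv ->]
    /imsetP[c cx ->] /imsetP[f fy ->]]]]]].
  have pos (z : 'I_n) : 0 < ordS z -> ordS z = z.+1 :> nat.
    by case lz: (z.+1 < n); rewrite ?(ordS_nlast _ lz) ?(ordS_last _ lz).
  move=> [ab bc cf]; have eq_b := pos b (leq_ltn_trans (leq0n _) ab).
  have eq_c := pos c (leq_ltn_trans (leq0n _) bc).
  have eq_f := pos f (leq_ltn_trans (leq0n _) cf).
  rewrite eq_b in ab bc; rewrite eq_c in bc cf; rewrite eq_f in cf.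
  (* The images of [b], [c] and [f] are positive, so only [a] can be the last index; it then comes
     after the others. *)
  apply/orP; case la: (a.+1 < n).
    rewrite (ordS_nlast _ la) in ab.
    by left; apply/alternatingP; exists a, b, c, f.
  right; apply/alternatingP; exists b, c, f, a; split=> //; split=> //.
  have := ltn_ord f; have : f != a; last by rewrite ord_eqE; lia.
  by apply/eqP => fa; move: eq_f; rewrite fa (ordS_last _ la).
apply/idP/idP => /orP[]; last 2 first.
- exact: fwd.
- by move=> /fwd; rewrite interleaved_sym.
- exact: bwd.
- by move=> /bwd; rewrite interleaved_sym.
Qed.

(** * Diagonals and chord triangulations *)

(** With the endpoints in increasing order, [j.+1 < i + n] only excludes the side from [0] to
    [n - 1]. *)
Lemma diagonalP n (d : {set 'I_n}) :
  reflect (exists i j : 'I_n, [/\ d = [set i; j], i.+1 < j & j.+1 < i + n])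
          (d \in diagonals n).
Proof.
rewrite inE; apply: (iffP existsP) => -[i].
  move=> /existsP[j /and4P[/eqP ->]]; rewrite !ord_eqE !val_ordS.
  have [li lj] := (ltn_ord i, ltn_ord j); move=> ji jSi iSj.
  have [ij|ij] := ltnP i j.
    by exists i, j; split=> //; move: jSi iSj; do !case: ifP; lia.
  by exists j, i; rewrite setUC; split=> //; move: ji jSi iSj => /=; do !case: ifP; lia.
move=> [j [-> ij jn]]; exists i; apply/existsP; exists j.
rewrite eqxx !ord_eqE !val_ordS /=; have [li lj] := (ltn_ord i, ltn_ord j).
by do !case: ifP; lia.
Qed.

Lemma card_diagonal n (d : {set 'I_n}) : d \in diagonals n -> #|d| = 2.
Proof.
move=> /diagonalP[i [j [-> ij _]]]; rewrite cards2 ord_eqE.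
by case: eqP => // ?; lia.
Qed.

Lemma interleaved_irr n (d : {set 'I_n}) : d \in diagonals n -> interleaved d d = false.
Proof. by move=> /diagonalP[i [j [-> ij _]]]; rewrite interleaved_pair; lia. Qed.

(* Equivalent to maximality among the noncrossing sets of diagonals. *)
Definition chord_triangulation n (S : {set {set 'I_n}}) : bool :=
  (S \subset diagonals n) &&
  [forall d in diagonals n, (d \in S) == [forall e in S, ~~ interleaved d e]].

Lemma chord_triangulationP n (S : {set {set 'I_n}}) :
  reflect (S \subset diagonals n /\ forall d, d \in diagonals n ->
             (d \in S) = [forall e in S, ~~ interleaved d e])
          (chord_triangulation S).
Proof.
apply: (iffP andP) => -[sS H]; split=> //.
  by move=> d dD; have /forall_inP/(_ d dD)/eqP := H.
by apply/forall_inP => d dD; apply/eqP/H.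
Qed.

(** If [d] interleaves with no member of [S], then [d |: S] still satisfies [P], so maximality puts
    [d] in [S]. [P] is abstract so that the geometric predicate can be supplied later. *)
Lemma maxset_chord_triangulation n (P : pred {set {set 'I_n}}) (S : {set {set 'I_n}}) :
  (forall A, P A = (A \subset diagonals n) &&
     [forall d in A, forall e in A, ~~ interleaved d e]) ->
  maxset P S = chord_triangulation S.
Proof.
move=> PE; apply/maxsetP/chord_triangulationP => -[].
  rewrite PE => /andP[sS /forall_inP ncS] maxS; split=> // d dD.
  apply/idP/idP => [/ncS //|/forall_inP ncd].
  rewrite -(maxS (d |: S)) ?setU11 ?subsetUr // PE subUset sub1set dD sS /=.
  apply/forall_inP => x /setU1P xS; apply/forall_inP => y /setU1P yS.
  case: xS => [->|xS]; case: yS => [->|yS]; rewrite ?interleaved_irr ?ncd //.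
    by rewrite interleaved_sym ncd.
  by have /forall_inP := ncS x xS; apply.
move=> sS inS; split.
  by rewrite PE sS; apply/forall_inP => d dS; rewrite -inS // (subsetP sS).
move=> B; rewrite PE => /andP[sB /forall_inP ncB] SB.
apply/eqP; rewrite eqEsubset SB andbT; apply/subsetP => d dB.
rewrite inS ?(subsetP sB) //; apply/forall_inP => e /(subsetP SB) eB.
by have /forall_inP := ncB d dB; apply.
Qed.

(** * Rotation invariance of the ear-free count *)

(** [span2 c] cuts off the ear at [c], so removing these edges forbids ears at [m] consecutive
    vertices from [i] on. *)
Definition earfree_triangulations n m (i : 'I_n) : {set {set {set 'I_n}}} :=
  [set S | chord_triangulation S &&
           [forall t : 'I_m, span2 (iter t (@ordS n) i) \notin S]].

Definition num_earfree n m (i : 'I_n) : nat := #|earfree_triangulations m i|.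

Lemma ordS_inj n : injective (@ordS n).
Proof. exact: can_inj (@ordSK n). Qed.

Lemma diagonals_ordS n (d : {set 'I_n}) :
  ((@ordS n) @: d \in diagonals n) = (d \in diagonals n).
Proof.
rewrite !inE; apply/existsP/existsP => -[i /existsP[j /and4P[/eqP dE ji jSi iSj]]].
  exists (ord_pred i); apply/existsP; exists (ord_pred j).
  rewrite (inj_eq (can_inj (@ord_predK n))) !ord_predK ji.
  rewrite -(inj_eq (@ordS_inj n) (ord_pred j)) -(inj_eq (@ordS_inj n) (ord_pred i)).
  rewrite !ord_predK jSi iSj !andbT.
  by rewrite -(inj_eq (imset_inj (@ordS_inj n))) dE imsetU !imset_set1 !ord_predK.
exists (ordS i); apply/existsP; exists (ordS j).
by rewrite !(inj_eq (@ordS_inj n)) ji jSi iSj dE imsetU !imset_set1 eqxx.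
Qed.

Lemma span2_ordS n (i : 'I_n) : span2 (ordS i) = (@ordS n) @: span2 i.
Proof. by rewrite /span2 imsetU !imset_set1 ordSK ord_predK. Qed.

Lemma chord_triangulation_ordS n (S : {set {set 'I_n}}) :
  chord_triangulation [set (@ordS n) @: d | d : {set 'I_n} in S] = chord_triangulation S.
Proof.
have inj := imset_inj (@ordS_inj n).
have rotK (d : {set 'I_n}) : exists d' : {set 'I_n}, d = (@ordS n) @: d'.
  exists ((@ord_pred n) @: d); rewrite -imset_comp -[LHS]imset_id.
  by apply: eq_imset => x /=; rewrite ord_predK.
apply/chord_triangulationP/chord_triangulationP => -[/subsetP sS inS]; split.
- by apply/subsetP => d dS; rewrite -diagonals_ordS sS // imset_f.
- move=> d dD; have := inS ((@ordS n) @: d); rewrite diagonals_ordS => /(_ dD).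
  rewrite mem_imset // => ->; apply/forall_inP/forall_inP => nc e.
    by move=> eS; rewrite -interleaved_ordS nc ?imset_f.
  by move=> /imsetP[x xS ->]; rewrite interleaved_ordS nc.
- by apply/subsetP => _ /imsetP[d dS ->]; rewrite diagonals_ordS sS.
move=> d; have [{}d ->] := rotK d; rewrite diagonals_ordS mem_imset // => /inS ->.
apply/forall_inP/forall_inP => nc e.
  by move=> /imsetP[x xS ->]; rewrite interleaved_ordS nc.
by move=> eS; rewrite -interleaved_ordS nc ?imset_f.
Qed.

(** Rotation is injective on the finite type of chord sets, hence bijective, and it moves the
    forbidden ears one step further. *)
Lemma num_earfree_ordS n m (i : 'I_n) : num_earfree m (ordS i) = num_earfree m i.
Proof.
pose F (S : {set {set 'I_n}}) := [set (@ordS n) @: d | d : {set 'I_n} in S].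
have injF : injective F by apply/imset_inj/imset_inj/ordS_inj.
rewrite /num_earfree -[RHS](card_imset _ injF); apply: eq_card => S.
have [S' ->] : exists S', S = F S'.
  exists (invF injF S); by rewrite f_invF.
rewrite mem_imset // !inE chord_triangulation_ordS; congr (_ && _).
apply: eq_forallb => t; rewrite -iterSr iterS span2_ordS /F mem_imset //.
exact/imset_inj/ordS_inj.
Qed.

Lemma num_earfree_rot n m (i j : 'I_n) : num_earfree m i = num_earfree m j.
Proof.
case: n i j => [[]//|n] i j.
have to0 (k : 'I_n.+1) : num_earfree m k = num_earfree m (ord0 : 'I_n.+1).
  by rewrite [k]iter_ordS0; elim: (nat_of_ord k) => //= t; rewrite num_earfree_ordS.
by rewrite !to0.
Qed.

(** * Existence of ears *)

Lemma pair_in_diagonals n (i j : 'I_n) : i < j ->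
  ([set i; j] \in diagonals n) = (i.+1 < j) && (j.+1 < i + n).
Proof.
move=> ij; apply/diagonalP/andP => [[k [l [kl_ij kl ln]]]|[lt1 lt2]]; last by exists i, j.
have kE : k \in [set i; j] by rewrite kl_ij set21.
have lE : l \in [set i; j] by rewrite kl_ij set22.
by move: kl ln; case/set2P: kE lE => -> /set2P[] ->; lia.
Qed.

Lemma span2E n (p c q : 'I_n) :
  c = p.+1 :> nat -> q = c.+1 :> nat -> span2 c = [set p; q].
Proof.
move=> cp qc; rewrite /span2; congr [set _; _]; apply: ord_inj.
  by rewrite val_ord_pred cp.
by rewrite val_ordS qc; have := ltn_ord q; case: ifP; lia.
Qed.

(* A shortest chord among the members of [S] and the side from [0] to [n - 1]
   cuts off an ear: otherwise [x, x + 2] could be added at its end [x]. *)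
Lemma triangulation_has_ear n (S : {set {set 'I_n}}) : 3 < n ->
  chord_triangulation S -> exists2 c : 'I_n, 0 < c < n.-1 & span2 c \in S.
Proof.
move=> n3 /chord_triangulationP[/subsetP sS inS].
suff ear s (x y : 'I_n) : y = x + s.+2 :> nat ->
    [set x; y] \in S \/ (x = 0 :> nat /\ y = n.-1 :> nat) ->
    exists2 c : 'I_n, 0 < c < n.-1 & span2 c \in S.
  have lt0 : 0 < n by lia.
  have lt1 : n.-1 < n by lia.
  by apply: (ear (n - 3) (Ordinal lt0) (Ordinal lt1)); [rewrite /=; lia | right].
elim/ltn_ind: s x y => s IHs x y yE xyS.
have lt_y := ltn_ord y.
have lt1 : x.+1 < n by lia.
have lt2 : x.+2 < n by lia.
pose c := Ordinal lt1; pose z := Ordinal lt2.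
have [xzS|xzNS] := boolP ([set x; z] \in S).
  exists c; last by rewrite (span2E (erefl : c = x.+1 :> nat) (erefl : z = c.+1 :> nat)).
  by rewrite /=; lia.
(* A chord of span 2 would be [[set x; z]] itself, which is not in [S]; the side from [0] to [n - 1]
   has span 2 only if [n = 3]. *)
case: s => [|s] in IHs yE.
  have yz : y = z by apply: ord_inj; rewrite yE addn2.
  by case: xyS => [|[x0 yn]]; [rewrite yz (negbTE xzNS) | lia].
have xz : x < z by rewrite /=; lia.
have xzD : [set x; z] \in diagonals n by rewrite pair_in_diagonals //=; lia.
move: xzNS; rewrite inS // => /forall_inPn[e eS].
have /diagonalP[a [b [eE ab bn]]] := sS e eS.
rewrite negbK eE interleaved_pair /=; [|lia..] => xzab.
have cross_xy : [set x; y] \in S -> ~~ ((a < x) && (x < b) && (b < y)).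
  move=> xyS'; have := inS _ (sS _ xyS'); rewrite xyS' => /esym/forall_inP/(_ e eS).
  by rewrite eE interleaved_pair; lia.
have cross_xy' : [set x; y] \in S -> ~~ ((x < a) && (a < y) && (y < b)).
  move=> xyS'; have := inS _ (sS _ xyS'); rewrite xyS' => /esym/forall_inP/(_ e eS).
  by rewrite eE interleaved_pair; lia.
have [la lb] := (ltn_ord a, ltn_ord b).
(* A chord crossing [[set x; z]] ends at [x + 1]. It does not cross the chord from [x] to [y], so
   its other end is at most [y] and its span is smaller. *)
have abE : [/\ a = x.+1 :> nat, x.+2 < b & b <= y].
  case: xyS => [xyS|[x0 yn]].
    by have := cross_xy xyS; have := cross_xy' xyS; split; lia.
  by split; lia.
case: abE => aE xb le_by.
apply: (IHs (b - a - 2) _ a b); [lia.. | by left; rewrite -eE].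
Qed.

(** Once rotated to start at 1, the forbidden vertices include [1, ..., n - 2], and one of these
    always carries an ear. *)
Lemma num_earfree_eq0 n m (i : 'I_n) : 3 < n -> n.-2 <= m -> num_earfree m i = 0.
Proof.
move=> n3 nm; have lt1 : 1 < n by lia.
rewrite (num_earfree_rot m i (Ordinal lt1)); apply/eqP; rewrite cards_eq0.
apply/eqP/setP => S; rewrite !inE; apply/negP => /andP[triS /forallP noear].
have [c /andP[c0 cn] cS] := triangulation_has_ear n3 triS.
have lt_t : c.-1 < m by lia.
have := noear (Ordinal lt_t); rewrite (_ : iter _ _ _ = c) ?cS //.
by apply: ord_inj; rewrite val_iter_ordS /=; lia.
Qed.

(** * Cutting off the ear at the last vertex *)

Definition widen1 n (i : 'I_n) : 'I_n.+1 := widen_ord (leqnSn n) i.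

Lemma widen1_inj n : injective (@widen1 n).
Proof. by move=> i j /(congr1 val) /= /ord_inj. Qed.

Lemma interleaved_widen1 n (d e : {set 'I_n}) :
  interleaved ((@widen1 n) @: d) ((@widen1 n) @: e) = interleaved d e.
Proof. exact: interleaved_imset_mono. Qed.

Definition add_ear n (S : {set {set 'I_n}}) : {set {set 'I_n.+1}} :=
  span2 (ord_max : 'I_n.+1) |: [set (@widen1 n) @: d | d : {set 'I_n} in S].

Lemma last_earE n : span2 (ord_max : 'I_n.+2) = [set ord0; widen1 ord_max].
Proof.
rewrite /span2 setUC; congr [set _; _]; apply: ord_inj.
  by rewrite val_ordS eqxx.
by rewrite val_ord_pred.
Qed.

Lemma last_ear_diagonal n : 2 < n -> span2 (ord_max : 'I_n.+1) \in diagonals n.+1.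
Proof. by case: n => // n n1; rewrite last_earE pair_in_diagonals //=; lia. Qed.

Lemma widen1_neq_last_ear n (d : {set 'I_n}) : 2 < n -> d \in diagonals n ->
  (@widen1 n) @: d != span2 (ord_max : 'I_n.+1).
Proof.
case: n d => // n d n2 /diagonalP[i [j [-> ij jn]]]; rewrite last_earE imsetU !imset_set1.
apply/eqP => /setP eq_d; have := eq_d (widen1 i); have := eq_d (widen1 j).
by rewrite !inE !eqxx orbT !ord_eqE /= => /esym + /esym; lia.
Qed.

Lemma widen1_diagonal n (d : {set 'I_n}) :
  d \in diagonals n -> (@widen1 n) @: d \in diagonals n.+1.
Proof.
move=> /diagonalP[i [j [-> ij jn]]]; rewrite imsetU !imset_set1.
by apply/diagonalP; exists (widen1 i), (widen1 j); split=> //=; lia.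
Qed.

Lemma interleaved_last_ear n (d : {set 'I_n}) : 2 < n -> d \in diagonals n ->
  interleaved ((@widen1 n) @: d) (span2 (ord_max : 'I_n.+1)) = false.
Proof.
case: n d => // n d n2 /diagonalP[i [j [-> ij jn]]]; rewrite last_earE imsetU !imset_set1.
by rewrite interleaved_pair //=; have := ltn_ord j; lia.
Qed.

(** The diagonals that cross this ear are exactly those ending at the last vertex. *)
Lemma noninterleaved_last_ear n (d : {set 'I_n.+1}) : 2 < n -> d \in diagonals n.+1 ->
  ~~ interleaved d (span2 ord_max) ->
  d = span2 ord_max \/
  exists2 d' : {set 'I_n}, d' \in diagonals n & d = (@widen1 n) @: d'.
Proof.
case: n d => // n d n2 /diagonalP[i [j [-> ij jn]]].
rewrite last_earE interleaved_pair /=; [|lia..].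
move=> nc; have lt_j := ltn_ord j.
have j_lt : j < n.+1 by lia.
have i_lt : i < n.+1 by lia.
have wi : i = widen1 (Ordinal i_lt) by apply: ord_inj.
have wj : j = widen1 (Ordinal j_lt) by apply: ord_inj.
(* Among pairs below the last vertex, this one is the ear; in the smaller polygon it is a side and
   not a diagonal. *)
case: (boolP ((i == 0 :> nat) && (j == n :> nat))) => [/andP[/eqP i0 /eqP jE]|ne].
  by left; congr [set _; _]; apply: ord_inj.
right; exists [set Ordinal i_lt; Ordinal j_lt].
  by rewrite pair_in_diagonals /=; lia.
by rewrite imsetU !imset_set1 -wi -wj.
Qed.

Lemma mem_add_ear n (S : {set {set 'I_n}}) (d : {set 'I_n}) :
  2 < n -> d \in diagonals n ->
  ((@widen1 n) @: d \in add_ear S) = (d \in S).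
Proof.
move=> n2 dD; rewrite in_setU1 (negbTE (widen1_neq_last_ear n2 dD)) /= mem_imset //.
exact/imset_inj/widen1_inj.
Qed.

Lemma noninterleaved_add_ear n (S : {set {set 'I_n}}) (d : {set 'I_n}) :
  2 < n -> d \in diagonals n ->
  [forall e in add_ear S, ~~ interleaved ((@widen1 n) @: d) e] =
  [forall e in S, ~~ interleaved d e].
Proof.
move=> n2 dD; apply/forall_inP/forall_inP => nc e eS.
  by rewrite -interleaved_widen1 nc // in_setU1 imset_f ?orbT.
case/setU1P: eS => [->|/imsetP[e' e'S ->]]; first by rewrite interleaved_last_ear.
by rewrite interleaved_widen1 nc.
Qed.

(** A diagonal that crosses the ear is rejected and not a member; the ear itself crosses nothing in
    [add_ear S]; any other diagonal comes from the smaller polygon, where the ear adds no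
    condition. *)
Lemma chord_triangulation_add_ear n (S : {set {set 'I_n}}) :
  2 < n -> S \subset diagonals n ->
  chord_triangulation (add_ear S) = chord_triangulation S.
Proof.
move=> n2 /subsetP sS; apply/chord_triangulationP/chord_triangulationP.
all: move=> -[sS' inS]; split.
- exact/subsetP.
- by move=> d dD; rewrite -mem_add_ear // inS ?widen1_diagonal // noninterleaved_add_ear.
- apply/subsetP => d /setU1P[->|/imsetP[d' /sS d'D ->]]; first exact: last_ear_diagonal.
  exact: widen1_diagonal.
move=> d dD; have [crs|nc] := boolP (interleaved d (span2 ord_max)).
  transitivity false; last first.
    by apply/esym/forall_inPn; exists (span2 ord_max); rewrite ?setU11 ?negbK.
  apply/negP => /setU1P[dE|/imsetP[d' /sS d'D dE]].
    by move: crs; rewrite dE interleaved_irr // last_ear_diagonal.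
  by move: crs; rewrite dE interleaved_last_ear.
have [->|[d' d'D ->]] := noninterleaved_last_ear n2 dD nc; last first.
  by rewrite mem_add_ear // noninterleaved_add_ear // inS.
rewrite setU11; apply/esym/forall_inP => e /setU1P[->|/imsetP[e' /sS e'D ->]].
  by rewrite interleaved_irr // last_ear_diagonal.
by rewrite interleaved_sym interleaved_last_ear.
Qed.

(** No member of [S] crosses the ear, so all others come from the smaller polygon; [S'] is their
    preimage. *)
Lemma triangulation_with_last_ear n (S : {set {set 'I_n.+1}}) : 2 < n ->
  chord_triangulation S -> span2 ord_max \in S ->
  exists2 S' : {set {set 'I_n}}, S' \subset diagonals n & S = add_ear S'.
Proof.
move=> n2 /chord_triangulationP[/subsetP sS inS] earS.
exists [set d in diagonals n | (@widen1 n) @: d \in S].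
  by apply/subsetP => d; rewrite inE => /andP[].
apply/setP => d; apply/idP/setU1P => [dS|[->//|/imsetP[d' + ->]]]; last first.
  by rewrite inE => /andP[].
have nc : ~~ interleaved d (span2 ord_max).
  by have := inS d (sS d dS); rewrite dS => /esym/forall_inP; apply.
have [->|[d' d'D dE]] := noninterleaved_last_ear n2 (sS d dS) nc; first by left.
by right; apply/imsetP; exists d'; rewrite // inE d'D -dE.
Qed.

(** Restricted to sets of diagonals because the side from [0] to [n - 1] widens to the ear
    itself. *)
Lemma add_ear_inj n (S S' : {set {set 'I_n}}) : 2 < n ->
  S \subset diagonals n -> S' \subset diagonals n -> add_ear S = add_ear S' -> S = S'.
Proof.
move=> n2 /subsetP sS /subsetP sS' eqS; apply/setP => d.
have [dD|dND] := boolP (d \in diagonals n); first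
  by rewrite -(mem_add_ear S n2 dD) eqS mem_add_ear.
by rewrite (contraNF (sS d) dND) (contraNF (sS' d) dND).
Qed.

(* The ear at the vertex before the last one is automatically absent. *)
Lemma earfree_add_ear n m (i : 'I_n.+1) (j : 'I_n) (S : {set {set 'I_n}}) :
  2 < n -> S \subset diagonals n -> m.+2 <= n -> i = n - m :> nat ->
  (0 < m -> j = n - m :> nat) ->
  [forall t : 'I_m, span2 (iter t (@ordS n.+1) i) \notin add_ear S] =
  [forall t : 'I_m.-1, span2 (iter t (@ordS n) j) \notin S].
Proof.
move=> n2 sS mn iE jE.
(* For [t < m - 1] the vertex [n - m + t] is at most [n - 2], so its ear avoids the last vertex and
   has the same endpoints in both polygons. *)
have earE (t : nat) : t < m.-1 ->
    span2 (iter t (@ordS n.+1) i) = (@widen1 n) @: span2 (iter t (@ordS n) j)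
    /\ span2 (iter t (@ordS n) j) \in diagonals n.
  move=> tm; have {}jE : j = n - m :> nat by apply: jE; lia.
  have ic : iter t (@ordS n.+1) i = n - m + t :> nat by rewrite val_iter_ordS iE; lia.
  have jc : iter t (@ordS n) j = n - m + t :> nat by rewrite val_iter_ordS jE; lia.
  have lt_p : (n - m + t).-1 < n by lia.
  have lt_q : (n - m + t).+1 < n by lia.
  have -> : span2 (iter t (@ordS n) j) = [set Ordinal lt_p; Ordinal lt_q].
    by apply: span2E; rewrite jc /=; lia.
  rewrite pair_in_diagonals /=; [|lia]; split; last by lia.
  by rewrite imsetU !imset_set1; apply: span2E; rewrite ic /=; lia.
apply/forallP/forallP => noear t.
  have [tE tD] := earE t (ltn_ord t).
  have tm : t < m by have := ltn_ord t; lia.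
  by have := noear (Ordinal tm); rewrite tE mem_add_ear.
have [tm|tm] := ltnP t m.-1.
  have [tE tD] := earE t tm.
  by rewrite tE mem_add_ear //; have := noear (Ordinal tm).
(* Here [t = m - 1] and the vertex is [n - 1]. Its ear ends at the last vertex, unlike every chord
   of [add_ear S]. *)
have lt_t := ltn_ord t.
have ic : iter t (@ordS n.+1) i = n.-1 :> nat by rewrite val_iter_ordS iE; lia.
have lt_p : n.-2 < n.+1 by lia.
have -> : span2 (iter t (@ordS n.+1) i) = [set Ordinal lt_p; ord_max].
  by apply: span2E; rewrite ic /=; lia.
apply/negP => /setU1P[|/imsetP[d _ eq_d]].
  case: n {i j S sS mn iE jE earE noear ic} n2 lt_p => // n n2 lt_p; rewrite last_earE.
  by move=> /setP/(_ ord_max); rewrite !inE eqxx orbT !ord_eqE /=; lia.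
have : ord_max \in (@widen1 n) @: d by rewrite -eq_d set22.
by move=> /imsetP[x _ /(congr1 val) /=]; have := ltn_ord x; lia.
Qed.

(** * The recurrence and the array *)

Lemma num_earfree_rec n m (i k : 'I_n.+1) (j : 'I_n) : 2 < n -> m.+2 <= n ->
  num_earfree m i = num_earfree m.-1 j + num_earfree m.+1 k.
Proof.
move=> n2 mn; have lt_i : n - m < n.+1 by lia.
(* For [m = 0] the number [n - m] is not an index of the smaller polygon, but then no ear is
   forbidden there and any start will do. *)
have [j' j'E] : exists j' : 'I_n, 0 < m -> j' = n - m :> nat.
  case: m mn {lt_i} => [|m] mn; first by exists j.
  have lt_j : n - m.+1 < n by lia.
  by exists (Ordinal lt_j).
(* The forbidden vertices become [n - m, ..., n - 1], so that the next one is the last vertex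
   [n]. *)
rewrite (num_earfree_rot m i (Ordinal lt_i)) (num_earfree_rot _ k (Ordinal lt_i)).
rewrite (num_earfree_rot _ j j').
set i' := Ordinal lt_i; pose A := earfree_triangulations m i'.
pose E := [set S : {set {set 'I_n.+1}} | span2 ord_max \in S].
(* Members of [A] with the last ear correspond to the smaller polygon through [add_ear]; for the
   others, the missing last ear is the extra condition at [t = m]. *)
rewrite /num_earfree -/A -(cardsID E A); congr (_ + _).
  rewrite -(card_in_imset (f := @add_ear n)); last first.
    move=> S S'; rewrite !inE => /andP[/chord_triangulationP[sS _] _].
    by move=> /andP[/chord_triangulationP[sS' _] _]; apply: add_ear_inj.
  apply: eq_card => S; apply/setIP/imsetP; rewrite !inE.
    move=> [/andP[triS noear] earS].
    have [S' sS' SE] := triangulation_with_last_ear n2 triS earS.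
    exists S' => //; rewrite inE -chord_triangulation_add_ear // -SE triS /=.
    by rewrite -(@earfree_add_ear _ _ i') // -SE.
  move=> [S']; rewrite inE => /andP[triS' noear] ->.
  have /chord_triangulationP[sS' _] := triS'.
  rewrite chord_triangulation_add_ear // triS' setU11; split=> //=.
  by rewrite (@earfree_add_ear _ _ i' j').
apply: eq_card => S; rewrite !inE andbC -andbA; congr (_ && _).
have iter_last : iter m (@ordS n.+1) i' = ord_max.
  by apply: ord_inj; rewrite val_iter_ordS /=; lia.
apply/andP/forallP => [[/forallP noear lastS] t|noear].
  have := ltn_ord t; rewrite ltnS leq_eqVlt => /orP[/eqP ->|tm].
    by rewrite iter_last.
  exact: (noear (Ordinal tm)).
split; last by have := noear ord_max; rewrite iter_last.
by apply/forallP => t; exact: (noear (widen_ord (leqnSn m) t)).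
Qed.

Lemma num_earfree3 (i : 'I_3) : num_earfree 0 i = 1.
Proof.
have D0 : diagonals 3 = set0.
  apply/setP => d; rewrite in_set0; apply/negP => /diagonalP[x [y [_]]].
  by have := ltn_ord y; lia.
apply/eqP/cards1P; exists set0; apply/setP => S; rewrite !inE.
have -> : [forall t : 'I_0, span2 (iter t (@ordS 3) i) \notin S] by apply/forallP => -[].
rewrite andbT; apply/chord_triangulationP/eqP => [[]|->].
  by rewrite D0 subset0 => /eqP.
by split=> [|d]; rewrite ?sub0set // D0 inE.
Qed.

(** The last condition excludes [n = 3], [m = 1]: there the span-2 edge is a side, and the count is
    1 while [a 1 1 = 0]. *)
Lemma num_earfree_catalan (a : nat -> nat -> nat) n m (i : 'I_n) :
  catalan_array a -> 2 < n -> m <= n - 2 -> (m == 0) || (3 < n) ->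
  num_earfree m i = a (n - 2) m.
Proof.
move=> [a0 akk ak0 akj]; elim: n m i => // n IHn m i n2 mn m0.
have [n3|n3] := ltnP 2 n; last first.
  have nE : n = 2 by lia.
  have mE : m = 0 by move: m0; rewrite nE orbF => /eqP.
  by case: _ / (esym nE) i => i in n2 mn *; rewrite mE num_earfree3 ak0 // a0 akk.
(* The polygon has [n + 1] vertices; the inner induction runs downward in [m] from [n - 1], where
   both sides vanish. *)
have [s sE] : exists s, n - 1 = m + s by exists (n - 1 - m); lia.
elim: s m i sE {mn m0} => [|s IHs] m i sE.
  rewrite num_earfree_eq0 //; last by lia.
  by rewrite (_ : m = n.+1 - 2) ?akk //; lia.
have lt0 : 0 < n by lia.
rewrite (num_earfree_rec i i (Ordinal lt0)) //; last by lia.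
rewrite IHs; last by lia.
have ih : num_earfree m.-1 (Ordinal lt0) = a (n - 2) m.-1.
  by apply: IHn => //; lia.
rewrite ih; have kE : (n.+1 - 2).-1 = n - 2 by lia.
(* For [m = 0] the value [m.-1 = 0] matches the boundary rule for [a k 0]. *)
case: m sE {ih} => [|m] sE; first by rewrite (ak0 (n.+1 - 2)) ?kE //; lia.
by rewrite (akj (n.+1 - 2) m.+1) ?kE //; lia.
Qed.

(** * Crossing segments and interleaved chords *)

Section Crossing.
Local Open Scope ring_scope.

Lemma in_open_segment_pair (R : realFieldType) n (v : 'I_n -> 'rV[R]_2) (i j : 'I_n)
    (p : 'rV[R]_2) :
  in_open_segment v [set i; j] p <->
  exists t : R, 0 < t < 1 /\ p = (1 - t) *: v i + t *: v j.
Proof.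
split=> [[k [l [t [eq_kl t01 ->]]]]|[t [t01 ->]]]; last by exists i, j, t.
have k_in : k \in [set i; j] by rewrite eq_kl set21.
have l_in : l \in [set i; j] by rewrite eq_kl set22.
have i_in : i \in [set k; l] by rewrite -eq_kl set21.
have j_in : j \in [set k; l] by rewrite -eq_kl set22.
have [[-> ->]|[-> ->]] : (k = i /\ l = j) \/ (k = j /\ l = i).
  case/set2P: k_in i_in j_in => ->; case/set2P: l_in => -> i_in j_in.
  - by left; split=> //; move: j_in; rewrite setUid => /set1P.
  - by left.
  - by right.
  - by left; split=> //; move: i_in; rewrite setUid => /set1P.
  by exists t.
exists (1 - t); split; last by rewrite subKr addrC.
by case/andP: t01 => t0 t1; apply/andP; lra.
Qed.

(** The sign tells which of the two arcs cut off by the chord contains [x]. *)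
Lemma orient_chord_side (R : realFieldType) n (v : 'I_n -> 'rV[R]_2) (s : R) :
  (forall i j k : 'I_n, (i < j)%N -> (j < k)%N -> 0 < s * orient (v i) (v j) (v k)) ->
  forall a c x : 'I_n, (a < c)%N ->
  [/\ ((a < x)%N && (x < c)%N) -> s * orient (v a) (v c) (v x) < 0,
      ((x < a)%N || (c < x)%N) -> 0 < s * orient (v a) (v c) (v x) &
      (x == a) || (x == c) -> s * orient (v a) (v c) (v x) = 0].
Proof.
move=> os a c x ac; split.
- move=> /andP[ax xc]; rewrite orient_swap mulrN oppr_lt0; exact: os.
- by move=> /orP[xa|cx]; [rewrite orient_rot; apply: os | apply: os].
move=> /orP[/eqP ->|/eqP ->]; last by rewrite orientxx mulr0.
by rewrite -orient_rot orientxx mulr0.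
Qed.

(** If the endpoints alternate, each chord separates the ends of the other and the segments meet.
    Otherwise [b] and [f] lie weakly on one side of the line through [a] and [c], not both on it. *)
Lemma crossing_interleaved (R : realFieldType) n (v : 'I_n -> 'rV[R]_2)
    (d e : {set 'I_n}) :
  (3 <= n)%N -> convex_points v -> d \in diagonals n -> e \in diagonals n ->
  `[< crossing v d e >] = interleaved d e.
Proof.
move=> n3 /(convex_points_orient n3)[s os].
move=> /diagonalP[a [c [-> ac _]]] /diagonalP[b [f [-> bf _]]].
have {}ac : (a < c)%N by lia.
have {}bf : (b < f)%N by lia.
rewrite interleaved_pair //; set alternate := (X in _ = X).
have alt_neq : alternate -> [set a; c] <> [set b; f].
  move=> alt eq_ac; have : a \in [set b; f] by rewrite -eq_ac set21.
  have : c \in [set b; f] by rewrite -eq_ac set22.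
  by move: alt; rewrite /alternate !inE !ord_eqE; lia.
have position (x : 'I_n) :
    [|| (a < x)%N && (x < c)%N, (x < a)%N || (c < x)%N | (x == a) || (x == c)].
  by rewrite !ord_eqE; lia.
have b_in : ~~ alternate -> (a < b)%N && (b < c)%N -> ~~ ((f < a)%N || (c < f)%N).
  by rewrite /alternate; lia.
have b_out : ~~ alternate -> (b < a)%N || (c < b)%N -> ~~ ((a < f)%N && (f < c)%N).
  by rewrite /alternate; lia.
(* Ensures that the areas at [b] and [f] are not both zero. *)
have b_on : [set a; c] <> [set b; f] -> (b == a) || (b == c) ->
    ~~ ((f == a) || (f == c)).
  move=> ne hb; apply/negP => hf; apply: ne.
  have [-> ->] : b = a /\ f = c; last by [].
  by split; apply: ord_inj; move: hb hf; rewrite !ord_eqE; lia.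
have lt3 : (2 < n)%N by [].
(* The sign of [s] is unknown, so products of areas are compared after multiplication by the
   positive [s * s]. *)
have s0 : s != 0.
  have lt0 : (0 < n)%N by lia.
  have lt1 : (1 < n)%N by lia.
  apply: contraTneq (os (Ordinal lt0) (Ordinal lt1) (Ordinal lt3) isT isT) => ->.
  by rewrite mul0r ltxx.
have ss : 0 < s * s by rewrite -expr2 exprn_even_gt0.
have prod (x y : R) : x * y * (s * s) = (s * x) * (s * y) by ring.
have side := orient_chord_side os.
have [acb1 acb2 acb3] := side a c b ac.
have [acf1 acf2 acf3] := side a c f ac.
have [bfa1 bfa2 bfa3] := side b f a bf.
have [bfc1 bfc2 bfc3] := side b f c bf.
apply/asboolP/idP => [[ne [p [/in_open_segment_pair[t [t01 ->]]]]]|]; last first.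
  move=> alt; split; first exact: alt_neq.
  have [] := @segments_meet _ (v a) (v c) (v b) (v f).
  - rewrite -(pmulr_llt0 _ ss) prod; case/orP: alt => /and3P[h1 h2 h3].
      by rewrite nmulr_rlt0 ?acb1 ?acf2 ?h1 ?h2 ?h3 ?orbT.
    by rewrite pmulr_rlt0 ?acb2 ?acf1 ?h1 ?h2 ?h3 ?orbT.
  - rewrite -(pmulr_llt0 _ ss) prod; case/orP: alt => /and3P[h1 h2 h3].
      by rewrite pmulr_rlt0 ?bfa2 ?bfc1 ?h1 ?h2 ?h3 ?orbT.
    by rewrite nmulr_rlt0 ?bfa1 ?bfc2 ?h1 ?h2 ?h3 ?orbT.
  move=> t [t' [t01 t01' eq_p]]; exists ((1 - t) *: v a + t *: v c); split.
    by apply/in_open_segment_pair; exists t.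
  by apply/in_open_segment_pair; exists t'.
move=> /in_open_segment_pair[t' [t01' eq_p]]; apply/negPn/negP => nalt.
have nz x : s * x != 0 -> x != 0 by rewrite mulf_eq0 negb_or => /andP[].
apply: (segments_disjoint t01' _ _ eq_p).
  rewrite -(pmulr_lge0 _ ss) prod.
  have /or3P[hb|hb|/acb3 ->] := position b; last by rewrite mul0r.
    rewrite nmulr_rge0 ?acb1 //.
    have /or3P[/acf1/ltW //|hf|/acf3 -> //] := position f.
    by have := b_in nalt hb; rewrite hf.
  rewrite pmulr_rge0 ?acb2 //.
  have /or3P[hf|/acf2/ltW //|/acf3 -> //] := position f.
  by have := b_out nalt hb; rewrite hf.
have /or3P[hb|hb|hb] := position b.
- by rewrite nz // lt_eqF // acb1.
- by rewrite nz // gt_eqF // acb2.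
have /or3P[hf|hf|hf] := position f.
- by rewrite orbC nz // lt_eqF // acf1.
- by rewrite orbC nz // gt_eqF // acf2.
by have := b_on ne hb; rewrite hf.
Qed.

End Crossing.

(** * Transfer to geometric triangulations *)

(** A diagonal has two distinct ends, so for it lying in [K_edges m i] just means not being a
    removed edge. *)
Lemma num_triangulations_earfree (R : realFieldType) n m
    (v : 'I_n -> 'rV[R]_2) (i : 'I_n) :
  3 <= n -> convex_points v -> num_triangulations v (K_edges m i) = num_earfree m i.
Proof.
move=> n3 cv; apply: eq_card => S; rewrite !inE.
rewrite /triangulation (@maxset_chord_triangulation _ _ S); last first.
  move=> A; rewrite /noncrossing_diagonals; case sA: (A \subset diagonals n) => //=.
  move/subsetP: sA => sA; apply/forall_inP/forall_inP => nc d dA;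
    apply/forall_inP => e eA.
    by rewrite -(crossing_interleaved n3 cv) ?sA //; have /forall_inP := nc d dA; apply.
  by rewrite (crossing_interleaved n3 cv) ?sA //; have /forall_inP := nc d dA; apply.
case: (boolP (chord_triangulation S)) => //= /chord_triangulationP[/subsetP sS _].
apply/subsetP/forallP => [sK t|noear d dS].
  apply/negP => /sK; rewrite !inE => /andP[/imsetP[]]; by exists t.
rewrite !inE card_diagonal ?sS // eqxx andbT; apply/imsetP => -[t _ dE].
by have := noear t; rewrite -dE dS.
Qed.

Theorem theorem3 (R : realFieldType) :
  (forall (n m : nat)
     (u : 'I_n -> 'rV[R]_2) (v : 'I_n.-1 -> 'rV[R]_2) (w : 'I_n -> 'rV[R]_2)
     (i : 'I_n) (j : 'I_n.-1) (k : 'I_n),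
     (3 <= n)%N -> (1 <= m <= n.-1)%N ->
     K_defined n m -> K_defined n.-1 m.-1 -> K_defined n m.+1 ->
     convex_points u -> convex_points v -> convex_points w ->
     num_triangulations u (K_edges m i) =
       (num_triangulations v (K_edges m.-1 j)
        + num_triangulations w (K_edges m.+1 k))%N)
  /\
  (forall a : nat -> nat -> nat, catalan_array a ->
   forall (n m : nat) (v : 'I_n -> 'rV[R]_2) (i : 'I_n),
     (3 <= n)%N -> (m <= n - 2)%N -> K_defined n m ->
     convex_points v ->
     num_triangulations v (K_edges m i) = a (n - 2)%N m).
Proof.
split=> [[//|n] m u v w i j k n3 /andP[m1 mn] _ def_v def_w cu cv cw|].
  have n2 : 2 < n by move: def_v; rewrite /K_defined /=; lia.
  rewrite !num_triangulations_earfree //.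
  have [mn2|mn2] := leqP m.+2 n; first exact: num_earfree_rec.
  (* Now all three counts vanish. A smaller polygon with three vertices is impossible here:
     [K_defined 4 m.+1] would force [m = 1], which the recurrence covers. *)
  have n4 : 3 < n by move: def_w mn2; rewrite /K_defined /=; lia.
  by rewrite !num_earfree_eq0 //; lia.
move=> a ca n m v i n3 mn def_v cv.
rewrite num_triangulations_earfree // (num_earfree_catalan i ca) //.
by move: def_v; rewrite /K_defined; lia.
Qed.
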